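(* For any $\epsilon>0$ and $p\in(0,1]$, every (not necessarily bipartite) graph $G=(V,E)$ has a subgraph $Q\subseteq E$ of maximum degree $O\!\left(\frac{1}{\epsilon^3 p}\right)$ such that querying only the edges of $Q$ suffices to find a set $C\subseteq V$ with: 1. $C$ is a vertex cover of $G_p$ with probability $1$; 2. $\mathbb{E}|C| \le (2+\epsilon)\,\mathbb{E}[\nu(G_p)]$; 3. $Q$ and $C$ can be found in polynomial time.
   Context: Stochastic setting: $G=(V,E)$ is a given graph and $p\in(0,1]$ a parameter. $G_p$ denotes the random subgraph of $G$ on vertex set $V$ that contains each edge of $E$ independently with probability $p$. The algorithm does not know $G_p$; it chooses, non-adaptively (depending only on $G$ and $p$), a set $Q\subseteq E$ of edges to query, and learns exactly which edges of $Q$ are present in $G_p$; the output $C$ may depend only on $G$, $p$, this information, and internal randomness. ''Maximum degree of $Q$'' is the maximum degree of the graph $(V,Q)$. $\nu(H)$ denotes the size of a minimum vertex cover of a graph $H$.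
   Formalization: The maximum degree of Q is bounded by O(1/(min(ε,1)^3 p)) instead of O(1/(ε^3 p)): with one constant for all ε and p the literal bound fails for large ε and small p (Q would be empty on a disjoint union of edges); for ε ≤ 1 the bound is as stated. *)

(* Defs.v *)
From mathcomp Require Import all_boot all_order all_algebra.
From mathcomp Require Import reals.

Set Implicit Arguments.
Unset Strict Implicit.
Unset Printing Implicit Defensive.

Import Order.TTheory GRing.Theory Num.Theory.

(** * Graphs.  A simple graph on the finite vertex type [V] is its edge set, a
    set of two-element subsets of [V]; a subgraph is a subset of the edge set. *)

Section Graphs.
Variable V : finType.
Implicit Types (E H : {set {set V}}) (C : {set V}).

Definition is_graph E : bool := [forall e in E, #|e| == 2].

Definition degree H (v : V) : nat := #|[set e in H | v \in e]|.

Definition max_degree H : nat := \max_(v : V) degree H v.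

Definition vertex_cover H C : bool := [forall e in H, [exists v in e, v \in C]].

(** For a graph [H] the whole vertex set is a cover, so this is a minimum. *)
Definition nu H : nat := #|[arg min_(C < [set: V] | vertex_cover H C) #|C|]|.

End Graphs.

(** * Randomness *)

Section Randomness.
Local Open Scope ring_scope.
Variable R : realType.

(** The probability that [G_p] is [H], for [H \subset E]. *)
Definition realization_prob (V : finType) (p : R) (E H : {set {set V}}) : R :=
  \prod_(e in E) (if e \in H then p else 1 - p).

Definition expect_graph (V : finType) (p : R) (E : {set {set V}})
    (f : {set {set V}} -> R) : R :=
  \sum_(H in powerset E) realization_prob p E H * f H.

(** Expectation over [m] independent fair random bits. *)
Definition expect_bits (m : nat) (f : m.-tuple bool -> R) : R :=
  (\sum_(s : m.-tuple bool) f s) / 2 ^+ m.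

(** [G_p] and the random bits of the algorithm are independent. *)
Definition expect (V : finType) (p : R) (E : {set {set V}}) (m : nat)
    (f : {set {set V}} -> m.-tuple bool -> R) : R :=
  expect_graph p E (fun H => expect_bits (f H)).

Definition prob (V : finType) (p : R) (E : {set {set V}}) (m : nat)
    (P : {set {set V}} -> m.-tuple bool -> bool) : R :=
  expect p E (fun H s => (P H s)%:R).

End Randomness.

(** * Computation model: a structured random access machine with unit-cost
    addition and truncated subtraction and no multiplication, so that its
    polynomial time is the usual one (Cook and Reckhow).  The memory consists
    of arrays of natural numbers: [m a i] is cell [i] of array [a].  Array
    names are fixed in the program text, indices are computed. *)

Definition memory := nat -> nat -> nat.

Definition update (m : memory) (a i x : nat) : memory :=
  fun b j => if (b == a) && (j == i) then x else m b j.

Inductive expr : Type :=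
| Const of nat
| Get of nat & expr
| Add of expr & expr
| Sub of expr & expr.

Fixpoint eval (m : memory) (e : expr) : nat :=
  match e with
  | Const k => k
  | Get a e1 => m a (eval m e1)
  | Add e1 e2 => eval m e1 + eval m e2
  | Sub e1 e2 => eval m e1 - eval m e2
  end.

Fixpoint expr_cost (e : expr) : nat :=
  match e with
  | Const _ => 1
  | Get _ e1 => (expr_cost e1).+1
  | Add e1 e2 | Sub e1 e2 => (expr_cost e1 + expr_cost e2).+1
  end.

Inductive program : Type :=
| Skip
| Put of nat & expr & expr  (* Put a i e : store e in cell i of array a *)
| Seq of program & program
| If of expr & program & program
| While of expr & program.

(** [exec c m t m']: started in memory [m], the program [c] halts after [t]
    steps in memory [m'].  A test succeeds when its value is nonzero. *)
Inductive exec : program -> memory -> nat -> memory -> Prop :=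
| ExecSkip m : exec Skip m 1 m
| ExecPut m a i e :
    exec (Put a i e) m (expr_cost i + expr_cost e).+1
      (update m a (eval m i) (eval m e))
| ExecSeq c1 c2 m1 m2 m3 t1 t2 :
    exec c1 m1 t1 m2 -> exec c2 m2 t2 m3 ->
    exec (Seq c1 c2) m1 (t1 + t2).+1 m3
| ExecIfTrue e c1 c2 m m' t :
    eval m e <> 0 -> exec c1 m t m' ->
    exec (If e c1 c2) m (expr_cost e + t).+1 m'
| ExecIfFalse e c1 c2 m m' t :
    eval m e = 0 -> exec c2 m t m' ->
    exec (If e c1 c2) m (expr_cost e + t).+1 m'
| ExecWhileTrue e c m1 m2 m3 t1 t2 :
    eval m1 e <> 0 -> exec c m1 t1 m2 -> exec (While e c) m2 t2 m3 ->
    exec (While e c) m1 (expr_cost e + t1 + t2).+1 m3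
| ExecWhileFalse e c m :
    eval m e = 0 -> exec (While e c) m (expr_cost e).+1 m.

(** ** Encoding of inputs and outputs *)

(** Row-major adjacency matrix. *)
Definition edges_array (n : nat) (H : {set {set 'I_n}}) : nat -> nat :=
  fun k => [exists i : 'I_n, exists j : 'I_n,
              (k == i * n + j) && ([set i; j] \in H)].

Definition bits_array (s : seq bool) : nat -> nat := fun k => nth false s k.

(** A nonnegative real number is read through its binary expansion, of which
    the first [m] fractional digits are supplied: cell 0 holds the integer part
    and cell [k], for [0 < k <= m], the [k]-th digit after the binary point.
    The supply is limited since under unit cost a program could otherwise
    access digits at positions exponential in its running time. *)
Definition real_array (R : realType) (m : nat) (x : R) : nat -> nat :=
  fun k => if k == 0 then Num.truncn x
           else if k <= m then Num.truncn (2 ^+ k * x)%R %% 2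
           else 0.

(** Array 0 is for the output; the array [k.+1] holds the [k]-th input. *)
Definition input_memory (inputs : seq (nat -> nat)) : memory :=
  fun a => nth (fun=> 0) ((fun=> 0) :: inputs) a.

(** The inputs known before querying: the order [n] of the graph (in cell 0 of
    its array), the edges, and [p] and [eps] with [m] digits each. *)
Definition instance (R : realType) (m : nat) (eps p : R) (n : nat)
    (E : {set {set 'I_n}}) : seq (nat -> nat) :=
  [:: (fun k => if k == 0 then n else 0); edges_array E;
      real_array m p; real_array m eps].

Definition outputs_edges (n : nat) (m : memory) (H : {set {set 'I_n}}) : Prop :=
  forall i j : 'I_n, (m 0 (i * n + j) != 0) = ([set i; j] \in H).

Definition outputs_vertices (n : nat) (m : memory) (C : {set 'I_n}) : Prop :=
  forall i : 'I_n, (m 0 i != 0) = (i \in C).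

(** [c] halts on the given inputs within [t] steps, with output as specified. *)
Definition computes_within (c : program) (inputs : seq (nat -> nat)) (t : nat)
    (output : memory -> Prop) : Prop :=
  exists (t' : nat) (m : memory),
    [/\ exec c (input_memory inputs) t' m, t' <= t & output m].

(* Main.v *)
(* Give every vertex a capacity of N units, with 1/N of order eps^2 p, and load
   the edges of G greedily with at most one unit each. Let P be the saturated
   vertices and Q the edges avoiding P: every edge of Q is loaded, so Q has degree
   at most N. After the queries, load the realized edges of Q greedily with as much
   as the remaining capacities allow, and let C be the saturated vertices; it
   contains P, and it covers G_p. Then N |C| is at most twice the total load
   Y + Z, where Y is the deterministic and Z the second load.
   Conversely a realized edge can carry 1/p for each unit of Y it received. The
   resulting load of a vertex exceeds N only by a centered sum of independent
   terms whose variance is at most its deterministic load divided by p, which is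
   small against N^2; weak duality against a minimum cover then gives
   E[Y + Z] <= (1 + O(eps)) N E[nu(G_p)].
   The algorithm is deterministic and never multiplies: N is obtained by doubling,
   from the positions of the leading binary digits of p and eps. *)

Require Import Defs.
From mathcomp Require Import all_boot all_order all_algebra.
From mathcomp Require Import reals.
From mathcomp Require Import zify ring lra.

Set Implicit Arguments.
Unset Strict Implicit.
Unset Printing Implicit Defensive.

Import Order.TTheory GRing.Theory Num.Theory.

Local Open Scope ring_scope.

(** * Independent edges *)

Section Expectation.
Variables (R : realType) (V : finType) (p : R) (E : {set {set V}}).
Hypothesis p01 : 0 < p <= 1.
Local Notation Exp := (expect_graph p E).

Lemma realization_prob_ge0 H : 0 <= realization_prob p E H.
Proof.
case/andP: p01 => p0 p1; apply: prodr_ge0 => e _.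
by case: ifP => _; [apply: ltW | rewrite subr_ge0].
Qed.

Lemma expect_graphD f g : Exp (fun H => f H + g H) = Exp f + Exp g.
Proof. by rewrite -big_split; apply: eq_bigr => H _; rewrite mulrDr. Qed.

Lemma expect_graphZ a f : Exp (fun H => a * f H) = a * Exp f.
Proof. by rewrite mulr_sumr; apply: eq_bigr => H _; rewrite mulrCA. Qed.

Lemma expect_graph_sum (I : finType) (P : pred I) (f : I -> {set {set V}} -> R) :
  Exp (fun H => \sum_(i | P i) f i H) = \sum_(i | P i) Exp (f i).
Proof.
by rewrite exchange_big; apply: eq_bigr => H _; rewrite mulr_sumr.
Qed.

Lemma le_expect_graph (f g : {set {set V}} -> R) :
  (forall H : {set {set V}}, H \subset E -> f H <= g H) -> Exp f <= Exp g.
Proof.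
move=> fg; apply: ler_sum => H; rewrite powersetE => HE.
by rewrite ler_wpM2l ?realization_prob_ge0 ?fg.
Qed.

Lemma eq_expect_graph (f g : {set {set V}} -> R) :
  (forall H : {set {set V}}, H \subset E -> f H = g H) -> Exp f = Exp g.
Proof.
by move=> fg; apply: eq_bigr => H; rewrite powersetE => HE; rewrite fg.
Qed.

(** Independence in product form: distributing the product over the set of realized edges gives the
    sum over [H]. The moments below come from it by a choice of [phi]. *)
Lemma expect_graph_prod (phi : {set V} -> bool -> R) :
  Exp (fun H => \prod_(e in E) phi e (e \in H)) =
  \prod_(e in E) (p * phi e true + (1 - p) * phi e false).
Proof.
(* Outside [E] the factor [F] is 0 and [G] is 1, so only the subsets of [E] survive in the expansion
   over all sets [H]. *)
pose F e := if e \in E then p * phi e true else 0.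
pose G e := if e \in E then (1 - p) * phi e false else 1.
transitivity (\prod_e (F e + G e)).
  rewrite bigA_distr [RHS](bigID (fun H : {set {set V}} => H \in powerset E)) /=.
  rewrite [X in _ + X]big1 ?addr0 => [|H]; last first.
    rewrite inE => /subsetPn[e eH eE].
    by rewrite (bigD1 e) //= eH /F (negPf eE) mul0r.
  apply: eq_big => [H|H]; rewrite inE // => HE.
  rewrite -big_split big_mkcond; apply: eq_bigr => e _ /=.
  rewrite /F /G; case: ifP => eE; first by case: ifP.
  by case: ifP => // /(subsetP HE); rewrite eE.
rewrite [RHS]big_mkcond; apply: eq_bigr => e _.
by rewrite /F /G; case: ifP => // _; rewrite add0r.
Qed.

Lemma expect_graph_cst a : Exp (fun=> a) = a.
Proof.
transitivity (a * Exp (fun H => \prod_(e in E) 1)).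
  by rewrite -expect_graphZ; apply: eq_expect_graph => H _; rewrite big1 ?mulr1.
rewrite (expect_graph_prod (fun _ _ => 1)) big1 ?mulr1 // => e _; ring.
Qed.

(** An edge that carries [1 / p] when realized and 0 otherwise carries 1 on average; this is the
    deviation. *)
Definition noise (b : bool) : R := b%:R / p - 1.

Lemma noise_mean : p * noise true + (1 - p) * noise false = 0.
Proof.
have p0 : p != 0 by case/andP: p01 => /lt0r_neq0.
by rewrite /noise /=; field.
Qed.

Lemma expect_noise e : e \in E -> Exp (fun H => noise (e \in H)) = 0.
Proof.
move=> eE.
transitivity (Exp (fun H => \prod_(x in E) (if x == e then noise (x \in H) else 1))).
  apply: eq_expect_graph => H _.
  by rewrite (bigD1 e) //= eqxx big1 ?mulr1 // => x /andP[_ /negPf ->].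
rewrite (expect_graph_prod (fun x b => if x == e then noise b else 1)).
by rewrite (bigD1 e) //= eqxx noise_mean mul0r.
Qed.

Lemma expect_noiseM e e' : e \in E -> e' \in E -> e != e' ->
  Exp (fun H => noise (e \in H) * noise (e' \in H)) = 0.
Proof.
move=> eE e'E ee'.
pose phi x b := if (x == e) || (x == e') then noise b else 1.
transitivity (Exp (fun H => \prod_(x in E) phi x (x \in H))).
  apply: eq_expect_graph => H _; rewrite /phi.
  rewrite (bigD1 e) //= eqxx (bigD1 e') ?e'E 1?eq_sym //= eqxx orbT.
  by rewrite big1 ?mulr1 // => x /andP[/andP[_ /negPf ->] /negPf ->].
by rewrite expect_graph_prod (bigD1 e) //= /phi eqxx noise_mean mul0r.
Qed.

Lemma expect_noise_sqr e : e \in E -> Exp (fun H => noise (e \in H) ^+ 2) <= p^-1.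
Proof.
move=> eE; case/andP: p01 => p0 p1.
(* An indicator equals its square, so the squared noise is affine in the noise, with mean
   [1 / p - 1]. *)
have -> : Exp (fun H => noise (e \in H) ^+ 2) =
    Exp (fun H => (p^-1 - 2) * noise (e \in H) + (p^-1 - 1)).
  apply: eq_expect_graph => H _; rewrite /noise.
  by case: (e \in H) => /=; field; rewrite gt_eqF.
by rewrite expect_graphD expect_graphZ expect_noise // expect_graph_cst; lra.
Qed.

(** Distinct edges are uncorrelated, so only the diagonal survives; [a e ^+ 2 <= a e] then makes the
    bound linear in the weights. *)
Lemma expect_sqr_noise (P : pred {set V}) (a : {set V} -> R) :
  (forall e, 0 <= a e <= 1) ->
  Exp (fun H => (\sum_(e in E | P e) a e * noise (e \in H)) ^+ 2)
    <= (\sum_(e in E | P e) a e) / p.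
Proof.
move=> a01.
have p0 : 0 <= p^-1 by rewrite invr_ge0; case/andP: p01 => /ltW.
rewrite (_ : Exp _ = \sum_(e in E | P e) \sum_(e' in E | P e')
    (a e * a e') * Exp (fun H => noise (e \in H) * noise (e' \in H))); last first.
  under [RHS]eq_bigr => e _ do under eq_bigr => e' _ do rewrite -expect_graphZ.
  under [RHS]eq_bigr => e _ do rewrite -expect_graph_sum.
  rewrite -expect_graph_sum; apply: eq_expect_graph => H _.
  rewrite expr2 mulr_suml; apply: eq_bigr => e _.
  by rewrite mulr_sumr; apply: eq_bigr => e' _; ring.
rewrite mulr_suml; apply: ler_sum => e /andP[eE Pe].
rewrite (bigD1 e) /= ?eE // big1 ?addr0 => [|e' /andP[/andP[e'E _] ne]]; last first.
  by rewrite expect_noiseM ?mulr0 // eq_sym.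
have := expect_noise_sqr eE; under eq_expect_graph => H _ do rewrite expr2.
case/andP: (a01 e) => a0 a1 var; apply: le_trans (_ : a e * a e * p^-1 <= _).
  by rewrite ler_wpM2l ?mulr_ge0.
by rewrite ler_wpM2r // ler_piMl.
Qed.

End Expectation.

Lemma expect_bits_cst (R : realType) m (a : R) : expect_bits (fun _ : m.-tuple bool => a) = a.
Proof.
rewrite /expect_bits sumr_const card_tuple card_bool -[_ *+ _]mulr_natr natrX.
by rewrite mulfK // expf_neq0 // pnatr_eq0.
Qed.

(** * Weak duality *)

(** Handshake count: every edge has exactly two endpoints. *)
Lemma sum_incidences (V : finType) (E : {set {set V}}) (z : {set V} -> nat) :
  is_graph E ->
  (\sum_v \sum_(e in E | v \in e) z e = 2 * \sum_(e in E) z e)%N.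
Proof.
move=> /'forall_implyP graphE; rewrite (exchange_big_dep (mem E)) /=; last first.
  by move=> v e _ /andP[].
rewrite big_distrr; apply: eq_bigr => e eE /=.
rewrite eE /= sum_nat_const; congr (_ * _)%N.
exact/eqP/graphE.
Qed.

Lemma vertex_coverP (V : finType) (H : {set {set V}}) (C : {set V}) :
  reflect (forall e, e \in H -> exists2 v, v \in e & v \in C) (vertex_cover H C).
Proof.
apply: (iffP 'forall_implyP) => HC e /HC.
  by case/'exists_andP => v [ve vC]; exists v.
by case=> v ve vC; apply/'exists_andP; exists v.
Qed.

Lemma nu_cover (V : finType) (H : {set {set V}}) :
  is_graph H -> exists2 C : {set V}, vertex_cover H C & nu H = #|C|.
Proof.
(* What remains is that the starting point of the minimization, the whole vertex set, is a cover: no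
   edge is empty. *)
move=> /'forall_implyP graphH; rewrite /nu; case: arg_minnP => [|C HC _]; last by exists C.
apply/vertex_coverP => e /graphH /eqP e2.
by have /card_gt0P[v ve] : (0 < #|e|)%N by [rewrite e2]; exists v.
Qed.

(** * Expected size of the set of saturated vertices *)

Section Approximation.
Variables (R : realType) (V : finType) (p delta : R) (E : {set {set V}}) (N : nat).
Hypotheses (p01 : 0 < p <= 1) (delta01 : 0 < delta <= 1) (graphE : is_graph E).
Hypothesis N_gt0 : (0 < N)%N.
Variable y : {set V} -> nat.
Hypothesis y_le1 : forall e, (y e <= 1)%N.
(** The first alternative is the degenerate case of edge cap 0; in the second [N] is large enough to
    make the variance of the loads negligible. *)
Hypothesis y_thin : (\sum_(e in E) y e)%N = 0 \/ 1 <= 2 * delta ^+ 2 * N%:R * p.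

Let Y : R := (\sum_(e in E) y e)%:R.
Let xi (v : V) (H : {set {set V}}) : R :=
  \sum_(e in E | v \in e) (y e)%:R * noise p (e \in H).
Let xiE (H : {set {set V}}) : R := \sum_(e in E) (y e)%:R * noise p (e \in H).

(* Weak duality: [e] carries [y e / p + z e] if realized and nothing otherwise;
   [xi v H] is the random excess of the load of [v], and AM-GM
   [t <= delta N + t^2 / (4 delta N)] makes this excess summable. *)
Lemma dual_bound (H : {set {set V}}) (z : {set V} -> nat) :
  H \subset E -> (forall e, e \notin H -> z e = 0%N) ->
  (forall v, \sum_(e in E | v \in e) (y e + z e) <= N)%N ->
  Y + xiE H + (\sum_(e in E) z e)%:R <=
  N%:R * (1 + delta) * (nu H)%:R + (\sum_v xi v H ^+ 2) / (4 * delta * N%:R).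
Proof.
move=> HE zH load; case/andP: p01 => p0 p1; case/andP: delta01 => delta_gt0 _.
have graphH : is_graph H.
  by apply/'forall_implyP => e /(subsetP HE); move/'forall_implyP: graphE; apply.
have [C /vertex_coverP HC ->] := nu_cover graphH.
have NR0 : 0 < N%:R :> R by rewrite ltr0n.
pose g e : R := (y e)%:R + (y e)%:R * noise p (e \in H) + (z e)%:R.
have g_out e : e \notin H -> g e = 0.
  by move=> eH; rewrite /g (zH _ eH) (negPf eH) /noise /=; ring.
have g_ge0 e : 0 <= g e.
  case: (boolP (e \in H)) => [eH|/g_out -> //].
  rewrite /g eH /noise mul1r addrC mulrBr mulr1 addrC subrKC.
  by rewrite addr_ge0 ?mulr_ge0 // invr_ge0 ltW.
have -> : Y + xiE H + (\sum_(e in E) z e)%:R = \sum_(e in E) g e.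
  by rewrite /Y /xiE !natr_sum -!big_split.
have gC : \sum_(e in E) g e <= \sum_(v in C) \sum_(e in E | v \in e) g e.
  rewrite (exchange_big_dep (mem E)) /=; last by move=> v e _ /andP[].
  apply: ler_sum => e eE; case: (boolP (e \in H)) => [/HC[v ve vC]|/g_out ->].
    by rewrite (bigD1 v) ?vC ?eE //= lerDl sumr_ge0.
  by rewrite sumr_ge0.
apply: le_trans gC _.
have vload v : \sum_(e in E | v \in e) g e <=
    N%:R * (1 + delta) + xi v H ^+ 2 / (4 * delta * N%:R).
  have -> : \sum_(e in E | v \in e) g e =
      (\sum_(e in E | v \in e) (y e + z e))%:R + xi v H.
    rewrite natr_sum /xi -big_split; apply: eq_bigr => e _ /=.
    by rewrite /g natrD; ring.
  have loadR : (\sum_(e in E | v \in e) (y e + z e))%:R <= N%:R :> R.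
    by rewrite ler_nat.
  apply: le_trans (lerD loadR (lexx _)) _.
  rewrite mulrDr mulr1 -addrA lerD2l -subr_ge0.
  have -> : N%:R * delta + xi v H ^+ 2 / (4 * delta * N%:R) - xi v H =
      (xi v H - 2 * delta * N%:R) ^+ 2 / (4 * delta * N%:R).
    by field; rewrite !gt_eqF.
  by rewrite divr_ge0 ?sqr_ge0 ?mulr_ge0 // ltW.
apply: le_trans (ler_sum _ (fun v _ => vload v)) _.
rewrite big_split /= sumr_const -[_ *+ _]mulr_natr lerD2l mulr_suml.
(* Adding the nonnegative error terms of the vertices outside [C] makes the error independent of the
   cover. *)
rewrite [leRHS](bigID (mem C)) /= lerDl sumr_ge0 // => v _.
by rewrite divr_ge0 ?sqr_ge0 ?mulr_ge0 // ltW.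
Qed.

Variables (z : {set {set V}} -> {set V} -> nat) (C : {set {set V}} -> {set V}).
Hypothesis z_supp : forall (H : {set {set V}}) e, e \notin H -> z H e = 0%N.
Hypothesis load_le : forall (H : {set {set V}}) v, H \subset E ->
  (\sum_(e in E | v \in e) (y e + z H e) <= N)%N.
Hypothesis load_C : forall (H : {set {set V}}) v, H \subset E -> v \in C H ->
  (\sum_(e in E | v \in e) (y e + z H e))%N = N.

(** Every vertex of [C H] receives [N], and every edge load is counted at two endpoints: this is the
    source of the approximation factor 2. *)
Lemma card_tight (H : {set {set V}}) : H \subset E ->
  N%:R * #|C H|%:R <= 2 * (Y + (\sum_(e in E) z H e)%:R).
Proof.
move=> HE; rewrite /Y -natrD -!natrM ler_nat -big_split -sum_incidences //=.
rewrite mulnC -sum_nat_const.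
rewrite (eq_bigr _ (fun v vC => esym (load_C HE vC))).
by rewrite [leqRHS](bigID (mem (C H))) leq_addr.
Qed.

(** [card_tight] and [dual_bound] are combined for each [H], then averaged. The factor [1 - delta]
    on the left frees [2 * delta * Y], which pays for the expected quadratic noise; the linear noise
    has mean 0. *)
Lemma expect_tight_set :
  (1 - delta) * expect_graph p E (fun H => #|C H|%:R) <=
  2 * (1 + delta) * expect_graph p E (fun H => (nu H)%:R).
Proof.
case/andP: p01 => p0 p1; case/andP: delta01 => delta_gt0 delta_le1.
have NR0 : 0 < N%:R :> R by rewrite ltr0n.
have Y0 : 0 <= Y by rewrite ler0n.
have pathwise (H : {set {set V}}) : H \subset E ->
    (1 - delta) * (N%:R * #|C H|%:R) <= 2 * N%:R * (1 + delta) * (nu H)%:R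
      + (2 * delta * N%:R)^-1 * (\sum_v xi v H ^+ 2) + (-2) * xiE H + (- 2 * delta * Y).
  move=> HE; have tight := card_tight HE.
  have dual := dual_bound HE (z_supp (H := H)) (fun v => load_le v HE).
  have : 0 <= 1 - delta by rewrite subr_ge0.
  move=> /ler_wpM2l/(_ _ _ tight)/le_trans; apply.
  have -> : (2 * delta * N%:R)^-1 * (\sum_v xi v H ^+ 2) =
      2 * ((\sum_v xi v H ^+ 2) / (4 * delta * N%:R)).
    by field; rewrite !gt_eqF.
  have : 0 <= delta * (\sum_(e in E) z H e)%:R by rewrite mulr_ge0 // ltW.
  lra.
have := le_expect_graph p01 pathwise.
rewrite !expect_graphD !expect_graphZ expect_graph_sum expect_graph_cst //.
have -> : expect_graph p E xiE = 0.
  rewrite /xiE expect_graph_sum big1 // => e eE.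
  by rewrite expect_graphZ expect_noise ?mulr0.
(* Each vertex contributes at most its deterministic load over [p], and these loads add up to
   [2 * Y]. *)
have varE : \sum_v expect_graph p E (fun H => xi v H ^+ 2) <= 2 * Y / p.
  have -> : 2 * Y / p = \sum_v (\sum_(e in E | v \in e) (y e)%:R) / p.
    rewrite -mulr_suml; congr (_ / _).
    by rewrite /Y -natrM -sum_incidences // natr_sum; apply: eq_bigr => v _; rewrite natr_sum.
  apply: ler_sum => v _; apply: expect_sqr_noise => // e.
  by rewrite ler0n lern1 y_le1.
have noise_small : (2 * delta * N%:R)^-1 * (2 * Y / p) <= 2 * delta * Y.
  have -> : (2 * delta * N%:R)^-1 * (2 * Y / p) = Y / (delta * N%:R * p).
    by field; rewrite !gt_eqF.
  rewrite ler_pdivrMr ?mulr_gt0 //.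
  case: y_thin => [Y00|thin]; first by rewrite /Y Y00 !(mulr0, mul0r).
  have -> : 2 * delta * Y * (delta * N%:R * p) = Y * (2 * delta ^+ 2 * N%:R * p) by ring.
  by rewrite ler_peMr.
have dN0 : 0 <= (2 * delta * N%:R)^-1 by rewrite invr_ge0 !mulr_ge0 // ltW.
have := ler_wpM2l dN0 varE.
set c := (_)^-1 * \sum__ _ => c_le bound.
rewrite -(ler_pM2l NR0).
set a := expect_graph p E _ in bound *; set b := expect_graph p E _ in bound *.
have -> : N%:R * ((1 - delta) * a) = (1 - delta) * (N%:R * a) by ring.
have -> : N%:R * (2 * (1 + delta) * b) = 2 * N%:R * (1 + delta) * b by ring.
lra.
Qed.

End Approximation.

(** * Greedy loads *)

Local Open Scope nat_scope.

Lemma iteri_ind (T : Type) (P : nat -> T -> Prop) n (f : nat -> T -> T) x :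
  P 0 x -> (forall k y, k < n -> P k y -> P k.+1 (f k y)) -> P n (iteri n f x).
Proof.
move=> P0; elim: n => [|n IHn] PS //=.
by apply: (PS) => //; apply: IHn => k y kn; apply: PS; apply: ltnW.
Qed.

(** Quotient and remainder by [n] recover the pair from the row-major index. *)
Lemma edges_arrayE n (A : {set {set 'I_n}}) (i j : 'I_n) :
  edges_array A (i * n + j) = ([set i; j] \in A) :> nat.
Proof.
rewrite /edges_array; congr nat_of_bool; apply/idP/idP; last first.
  by move=> ijA; apply/existsP; exists i; apply/existsP; exists j; rewrite eqxx.
case/existsP => i' /existsP[j' /andP[/eqP eq_ij]].
have n_gt0 : 0 < n by apply: leq_ltn_trans (ltn_ord i).
have -> : i' = i.
  apply: val_inj; have := congr1 (divn^~ n) eq_ij.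
  by rewrite /= !divnMDl // !divn_small // !addn0.
have -> // : j' = j.
apply: val_inj; have := congr1 (modn^~ n) eq_ij.
by rewrite /= !modnMDl !modn_small.
Qed.

Lemma ordered_pair_inj n (i j i' j' : 'I_n) :
  j < i -> j' < i' -> [set i; j] = [set i'; j'] -> i = i' /\ j = j'.
Proof.
move=> ji ji' /setP eq_e.
have := eq_e i; have := eq_e j; have := eq_e i'; have := eq_e j'.
rewrite !inE !eqxx !orbT -!val_eqE /= => e1 e2 e3 e4.
by split; apply: val_inj => /=; lia.
Qed.

(* [l v] is the load already put on [v], out of a capacity of [N]; each pair
   [j < i] adjacent in [a] receives as much as [cap] and the capacities allow. *)
Definition greedy_step (a : nat -> nat) (cap N n i j : nat) (l : nat -> nat) :=
  if (j < i) && (a (i * n + j) != 0) then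
    let t := minn cap (minn (N - l i) (N - l j)) in
    fun k => if (k == i) || (k == j) then l k + t else l k
  else l.

Definition greedy_row a cap N n i l := iteri n (greedy_step a cap N n i) l.

Definition greedy a cap N n l := iteri n (greedy_row a cap N n) l.

Section GreedyLoad.
Variables (n : nat) (E A : {set {set 'I_n}}) (cap N : nat) (l0 : nat -> nat).
Hypotheses (graphE : is_graph E) (AE : A \subset E).
Hypothesis l0_le : forall v : 'I_n, l0 v <= N.

(** The program stores only vertex loads; the edge loads [z] are a ghost witness. Pairs before
    [(i, j)] in row-major order are settled, the others still carry 0. *)
Definition greedy_inv i j (l : nat -> nat) (z : {set 'I_n} -> nat) :=
  [/\ forall e, e \notin A -> z e = 0,
      forall e, z e <= cap,
      forall v : 'I_n, l v = l0 v + \sum_(e in E | v \in e) z e,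
      forall v : 'I_n, l v <= N &
      forall i' j' : 'I_n, j' < i' ->
        if (i' < i) || ((i' == i :> nat) && (j' < j)) then
          [set i'; j'] \in A -> [\/ z [set i'; j'] = cap, l i' = N | l j' = N]
        else z [set i'; j'] = 0].

Lemma greedy_step_inv i j l : i < n -> j < n ->
  (exists z, greedy_inv i j l z) ->
  exists z, greedy_inv i j.+1 (greedy_step (edges_array A) cap N n i j l) z.
Proof.
move=> i_lt j_lt [z [zA z_cap lz l_le done_ij]].
pose io := Ordinal i_lt; pose jo := Ordinal j_lt.
rewrite /greedy_step (edges_arrayE A io jo) eqb0 negbK.
case: ifP => [/andP[ji e0A]|not_e0]; last first.
  exists z; split=> // i' j' ji'; have := done_ij i' j' ji'.
  rewrite ltnS [j' <= j]leq_eqVlt.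
  case: (i' < i) => //=; case: eqP => //= eq_i; case: eqP => //= eq_j.
  have -> : i' = io by apply: val_inj.
  have -> : j' = jo by apply: val_inj.
  rewrite ltnn => _ eA; move: not_e0; rewrite eA andbT.
  by rewrite -eq_i -eq_j ji'.
set t := minn _ _; set e0 := [set io; jo] in e0A.
(* The current pair does not precede itself, so its load is 0 so far and becomes exactly [t]. *)
have z0 : z e0 = 0 by have := done_ij io jo ji; rewrite /= !ltnn eqxx.
have e0E : e0 \in E := subsetP AE _ e0A.
exists (fun e => z e + (e == e0) * t); split.
- by move=> e eA; rewrite zA //; case: eqP => // eq_e; rewrite eq_e e0A in eA.
- move=> e; case: eqP => [->|_]; last by rewrite addn0.
  by rewrite z0 mul1n /t geq_minl.
- move=> v; rewrite big_split addnA -lz.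
  have -> : \sum_(e in E | v \in e) (e == e0) * t = (v \in e0) * t.
    case: (boolP (v \in e0)) => ve0.
      rewrite (bigD1 e0) ?e0E ?ve0 //= eqxx big1 ?addn0 //.
      by move=> e /andP[_ /negPf ->].
    rewrite big1 // => e /andP[_ ve]; case: eqP => // eq_e.
    by rewrite eq_e (negPf ve0) in ve.
  rewrite !inE -!val_eqE /=.
  by case: ifP => _; rewrite ?mul1n ?addn0.
- move=> v; have := l_le v; rewrite /t.
  by case: eqP => [->|_] /=; [|case: eqP => [->|_]]; lia.
move=> i' j' ji'; have := done_ij i' j' ji'.
rewrite ltnS [j' <= j]leq_eqVlt.
have [eq_e|ne_e] := eqVneq [set i'; j'] e0.
  have [-> ->] := ordered_pair_inj (i' := io) (j' := jo) ji' ji eq_e.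
  rewrite /= ltnn !eqxx /= ltnn => _ _; rewrite -/e0 z0 mul1n orbT add0n /t.
  have := l_le io; have := l_le jo => /= lj li.
  have : [\/ t = cap, t = N - l i | t = N - l j].
    by rewrite /t /minn; case: ifP; case: ifP => _ _; [apply: Or31|apply: Or31|apply: Or32|apply: Or33].
  rewrite /t; case=> ->; [exact: Or31 | apply: Or32 | apply: Or33]; lia.
rewrite mul0n addn0.
have -> : (i' == i :> nat) && ((j' == j :> nat) || (j' < j)) =
          (i' == i :> nat) && (j' < j).
  case: eqP => //= eq_i; case: eqP => //= eq_j.
  by case/eqP: ne_e; congr [set _; _]; apply: val_inj.
case: ifP => // _ + eA => /(_ eA).
(* A saturated vertex stays saturated: if it is an end of the current pair, then [t] is 0. *)
have grow v : l v = N -> l v <= N -> (if (v == i) || (v == j) then l v + t else l v) = N.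
  move=> lv _; case: ifP => // /orP[] /eqP ev; rewrite /t -ev lv subnn ?(minn0, min0n); lia.
by case=> [?|li|lj]; [exact: Or31 | apply: Or32 | apply: Or33]; apply: grow.
Qed.

(** The last clause is maximality, on which both the degree bound and the covering property rest. *)
Lemma greedyP (l := greedy (edges_array A) cap N n l0) :
  exists z : {set 'I_n} -> nat,
  [/\ forall e, e \notin A -> z e = 0,
      forall e, z e <= cap,
      forall v : 'I_n, l v = l0 v + \sum_(e in E | v \in e) z e,
      forall v : 'I_n, l v <= N &
      forall e, e \in A -> z e = cap \/ exists2 v : 'I_n, v \in e & l v = N].
Proof.
have [z [zA z_cap lz l_le settled]] : exists z, greedy_inv n 0 l z.
  apply: (iteri_ind (P := fun i l => exists z, greedy_inv i 0 l z)).
    exists (fun=> 0); split=> //; first by move=> v; rewrite big1 ?addn0.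
    by move=> i' j' _; rewrite !ltn0 andbF.
  move=> i l1 i_lt inv_i.
  have [z [zA z_cap lz l_le settled]] : exists z, greedy_inv i n (greedy_row (edges_array A) cap N n i l1) z.
    apply: (iteri_ind (P := fun j l => exists z, greedy_inv i j l z)) => //.
    by move=> j l2 j_lt; apply: greedy_step_inv.
  exists z; split=> // i' j' /settled.
  by rewrite ltn_ord andbT ltn0 andbF orbF ltnS [i' <= i]leq_eqVlt orbC.
exists z; split=> // e eA.
have [i [j ne_ij def_e]] : exists i : 'I_n, exists2 j : 'I_n, j < i & e = [set i; j].
  have /cards2P[i [j [ne_ij ->]]] : #|e| == 2.
    by move/'forall_implyP: graphE; apply; apply: (subsetP AE).
  move: ne_ij; rewrite -val_eqE neq_ltn => /orP[] lt_ij; last by exists i, j.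
  by exists j, i => //; rewrite setUC.
have := settled i j ne_ij; rewrite ltn_ord /= -def_e => /(_ eA).
case=> [?|li|lj]; [by left | right; exists i | right; exists j] => //;
  by rewrite def_e !inE eqxx ?orbT.
Qed.

End GreedyLoad.

(** * Programs *)

(** A total correctness triple with a time bound; sequencing nests one triple in the postcondition
    of another. *)
Definition runs (c : program) (m : memory) (t : nat) (post : memory -> Prop) :=
  exists t' m', [/\ exec c m t' m', t' <= t & post m'].

Lemma runs_le t' c m t post : t' <= t -> runs c m t' post -> runs c m t post.
Proof.
by move=> le_t [s [m' [ex le_s post_m]]]; exists s, m'; split=> //; apply: leq_trans le_t.
Qed.

Lemma runs_post c m t (post' post : memory -> Prop) :
  runs c m t post' -> (forall m', post' m' -> post m') -> runs c m t post.
Proof. by move=> [s [m' [ex le_s post_m]]] sub; exists s, m'; split=> //; apply: sub. Qed.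

Lemma runs_seq c1 c2 m t1 t2 post :
  runs c1 m t1 (fun m1 => runs c2 m1 t2 post) -> runs (Seq c1 c2) m (t1 + t2).+1 post.
Proof.
move=> [s1 [m1 [ex1 le1 [s2 [m2 [ex2 le2 post_m]]]]]].
by exists (s1 + s2).+1, m2; split=> //; [apply: ExecSeq ex2 | rewrite ltnS leq_add].
Qed.

(** The iteration count [k] serves as variant. The loop may stop before [n] rounds, as the digit
    scan does. *)
Lemma runs_while n t (inv : nat -> memory -> Prop) e c m (post : memory -> Prop) :
  (forall k m', inv k m' ->
     if eval m' e == 0 then post m' else k < n /\ runs c m' t (inv k.+1)) ->
  inv 0 m -> runs (While e c) m (n * (t + expr_cost e).+1 + (expr_cost e).+1) post.
Proof.
move=> step.
have loop d k m1 : k + d = n -> inv k m1 ->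
    runs (While e c) m1 (d * (t + expr_cost e).+1 + (expr_cost e).+1) post.
  elim: d k m1 => [|d IHd] k m1 def_n inv_m; have := step k m1 inv_m.
    case: eqP => [e0 post_m|_ [lt_kn _]]; last by lia.
    by exists (expr_cost e).+1, m1; split=> //; apply: ExecWhileFalse.
  case: eqP => [e0 post_m|e1 [_ [s [m2 [ex le_s inv2]]]]].
    exists (expr_cost e).+1, m1; split=> //; [exact: ExecWhileFalse | lia].
  have [s' [m3 [ex' le_s' post_m]]] := IHd k.+1 m2 (etrans (addSnnS _ _) def_n) inv2.
  exists (expr_cost e + s + s').+1, m3; split=> //; first exact: ExecWhileTrue ex ex'.
  rewrite mulSn; lia.
exact: (loop n 0 m).
Qed.

(** * Loop-free programs, run by computation *)

Fixpoint loop_free (c : program) : bool :=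
  match c with
  | Skip | Put _ _ _ => true
  | Seq c1 c2 | If _ c1 c2 => loop_free c1 && loop_free c2
  | While _ _ => false
  end.

Fixpoint result (c : program) (m : memory) : memory :=
  match c with
  | Put a i e => update m a (eval m i) (eval m e)
  | Seq c1 c2 => result c2 (result c1 m)
  | If e c1 c2 => if eval m e == 0 then result c2 m else result c1 m
  | Skip | While _ _ => m
  end.

(** Both branches of a test are counted, which gives a bound independent of the memory. *)
Fixpoint duration (c : program) : nat :=
  match c with
  | Put _ i e => (expr_cost i + expr_cost e).+1
  | Seq c1 c2 => (duration c1 + duration c2).+1
  | If e c1 c2 => (expr_cost e + (duration c1 + duration c2)).+1
  | Skip | While _ _ => 1
  end.

Lemma runs_loop_free c m t (post : memory -> Prop) :
  loop_free c -> duration c <= t -> post (result c m) -> runs c m t post.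
Proof.
move=> lf le_t post_m.
have [s ex le_s] : exists2 s, exec c m s (result c m) & s <= duration c.
  elim: c m lf {le_t post_m} => //= [m _|a i e m _|c1 IH1 c2 IH2 m|e c1 IH1 c2 IH2 m].
  - by exists 1 => //; apply: ExecSkip.
  - by exists (expr_cost i + expr_cost e).+1 => //; apply: ExecPut.
  - case/andP => /IH1 ih1 /IH2 ih2.
    have [s1 ex1 le1] := ih1 m; have [s2 ex2 le2] := ih2 (result c1 m).
    by exists (s1 + s2).+1; [apply: ExecSeq ex2 | rewrite ltnS leq_add].
  case/andP => /IH1 ih1 /IH2 ih2; case: eqP => e0.
    have [s2 ex2 le2] := ih2 m; exists (expr_cost e + s2).+1; last by lia.
    exact: ExecIfFalse.
  have [s1 ex1 le1] := ih1 m; exists (expr_cost e + s1).+1; last by lia.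
  exact: ExecIfTrue.
by exists s, (result c m); split=> //; apply: leq_trans le_t.
Qed.

Local Notation Sub := Defs.Sub.

(* Array 8 holds the registers: 0 and 1 are the counters [i] and [j] of nested
   loops, 2 is [i * n], 3 the capacity of a vertex, 4 the cap of an edge,
   5 a temporary and 6 a digit position. Array 9 holds the loads. *)
Definition reg (c : nat) : expr := Get 8 (Const c).
Definition set_reg (c : nat) (e : expr) : program := Put 8 (Const c) e.
Definition order_expr : expr := Get 1 (Const 0).

Definition for_loop (c : nat) (body : program) : program :=
  Seq (set_reg c (Const 0))
    (While (Sub order_expr (reg c)) (Seq body (set_reg c (Add (reg c) (Const 1))))).

(** The row offset [i * n] is accumulated by addition, as the machine cannot multiply. *)
Definition for_pairs (body : program) : program :=
  Seq (set_reg 2 (Const 0))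
    (for_loop 0 (Seq (for_loop 1 body) (set_reg 2 (Add (reg 2) order_expr)))).

(** Per round, 13 is the test (5), the increment (6) and one step each for the sequence and the
    loop; 10 covers initialization and the failing test. *)
Lemma runs_for c body n t (inv : nat -> memory -> Prop) m (post : memory -> Prop) :
  (forall k x m', inv k m' -> inv k (update m' 8 c x)) ->
  (forall k m', inv k m' -> m' 1 0 = n) ->
  (forall k m', k < n -> inv k m' -> m' 8 c = k ->
     runs body m' t (fun m'' => inv k.+1 m'' /\ m'' 8 c = k)) ->
  (forall m', inv n m' -> post m') ->
  inv 0 m -> runs (for_loop c body) m (n * (t + 13) + 10) post.
Proof.
move=> inv_c inv_n inv_body inv_post inv0.
apply: (@runs_le (3 + (n * ((t + 6).+1 + 5).+1 + 6)).+1); first by lia.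
apply: runs_seq; apply: runs_loop_free => //=.
apply: (runs_while (inv := fun k m' => [/\ k <= n, inv k m' & m' 8 c = k])) => [k m'|].
  case=> le_kn inv_m cnt; rewrite /= cnt (inv_n _ _ inv_m).
  case: eqP => k_n; first by apply: inv_post; rewrite (_ : n = k) //; lia.
  have lt_kn : k < n by lia.
  split=> //; apply: runs_seq.
  apply: (runs_post (inv_body _ _ lt_kn inv_m cnt)) => m2 [inv2 cnt2].
  apply: runs_loop_free => //=; split=> //; first exact: inv_c.
  by rewrite /update !eqxx /= cnt2 addn1.
by split=> //; [apply: inv_c | rewrite /update !eqxx].
Qed.

Lemma runs_for_pairs body n t (inv : nat -> nat -> memory -> Prop) m (post : memory -> Prop) :
  (forall i j c x m', c < 3 -> inv i j m' -> inv i j (update m' 8 c x)) ->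
  (forall i j m', inv i j m' -> m' 1 0 = n) ->
  (forall i m', i < n -> inv i n m' -> inv i.+1 0 m') ->
  (forall i j m', i < n -> j < n -> inv i j m' ->
     m' 8 0 = i -> m' 8 1 = j -> m' 8 2 = i * n ->
     runs body m' t (fun m'' =>
       inv i j.+1 m'' /\ forall c, c < 3 -> m'' 8 c = m' 8 c)) ->
  (forall m', inv n 0 m' -> post m') ->
  inv 0 0 m -> runs (for_pairs body) m (n * (n * (t + 13) + 31) + 14) post.
Proof.
move=> inv_c inv_n inv_row inv_body inv_post inv0.
pose outer i m' := inv i 0 m' /\ m' 8 2 = i * n.
apply: (@runs_le (3 + (n * ((n * (t + 13) + 10 + 7).+1 + 13) + 10)).+1); first by lia.
apply: runs_seq; apply: runs_loop_free => //=.
apply: (runs_for (inv := outer)) =>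
  [k x m1 [inv1 base]|k m1 [inv1 _]|i m1 lt_in [inv1 base] cnt|m1 [inv1 _]|].
- by split; [apply: inv_c | rewrite /update].
- exact: inv_n inv1.
- apply: runs_seq.
  pose inner j m' := [/\ inv i j m', m' 8 0 = i & m' 8 2 = i * n].
  apply: (runs_for (inv := inner)) =>
    [j x m2 [inv2 i2 b2]|j m2 [inv2 _ _]|j m2 lt_jn [inv2 i2 b2] j2|m2 [inv2 i2 b2]|].
  + by split; [apply: inv_c | rewrite /update | rewrite /update].
  + exact: inv_n inv2.
  + apply: (runs_post (inv_body _ _ _ lt_in lt_jn inv2 i2 j2 b2)) => m3 [inv3 eq3].
    by split; [split|]; rewrite ?eq3.
  + apply: runs_loop_free => //=; split; last by rewrite /update /= i2.
    split; first by apply: inv_c => //; apply: inv_row.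
    by rewrite /update /= b2 (inv_n _ _ _ inv2) mulSn addnC.
  by split.
- exact: inv_post.
by split; [apply: inv_c | rewrite /update].
Qed.

Definition pair_cell (a : nat) : expr := Get a (Add (reg 2) (reg 1)).
Definition slack (v : expr) : expr := Sub (reg 3) (Get 9 v).

(** The minimum of [x] and [y] is computed as [x - (x - y)] with truncated subtraction. *)
Definition greedy_prog (a : nat) : program :=
  for_pairs (If (Sub (reg 0) (reg 1))
    (If (pair_cell a)
      (Seq (set_reg 5 (slack (reg 0)))
      (Seq (set_reg 5 (Sub (reg 5) (Sub (reg 5) (slack (reg 1)))))
      (Seq (set_reg 5 (Sub (reg 4) (Sub (reg 4) (reg 5))))
      (Seq (Put 9 (reg 0) (Add (Get 9 (reg 0)) (reg 5)))
           (Put 9 (reg 1) (Add (Get 9 (reg 1)) (reg 5)))))))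
      Skip) Skip).

(** Arrays 1 to 7 hold the inputs and stay intact. Array 0 is left free for the output, as are the
    counters and scratch registers of array 8. *)
Definition state (m0 : memory) (N cap : nat) (l : nat -> nat) (m : memory) :=
  [/\ forall a k, 0 < a < 8 -> m a k = m0 a k,
      m 8 3 = N, m 8 4 = cap & forall k, m 9 k = l k].

Lemma state_counter m0 N cap l m c x :
  c < 3 -> state m0 N cap l m -> state m0 N cap l (update m 8 c x).
Proof.
move=> c3 [inp mN mcap ml]; split=> [a k a8|||k] //; rewrite /update /=.
- by case: eqP => [a_eq|_] /=; [rewrite a_eq in a8 | apply: inp].
- by case: eqP => [eq_c|_] //; rewrite -eq_c in c3.
- by case: eqP => [eq_c|_] //; rewrite -eq_c in c3.
- exact: ml.
Qed.

Lemma minn_subn a b : a - (a - b) = minn a b.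
Proof. lia. Qed.

Lemma runs_greedy a m0 N cap l m n :
  0 < a < 8 -> m0 1 0 = n -> state m0 N cap l m ->
  runs (greedy_prog a) m (n * (n * 113 + 31) + 14)
    (state m0 N cap (greedy (m0 a) cap N n l)).
Proof.
move=> a8 def_n st.
pose rows i := iteri i (greedy_row (m0 a) cap N n) l.
pose inv i j := state m0 N cap (iteri j (greedy_step (m0 a) cap N n i) (rows i)).
apply: (runs_for_pairs (t := 100) (inv := inv)) => //.
- by move=> i j c x m1 c3; apply: state_counter.
- by move=> i j m1 [inp _ _ _]; rewrite inp.
move=> i j m1 lt_in lt_jn; rewrite /inv /=.
set l1 := iteri j _ _ => -[inp mN mcap ml] m_i m_j m_b.
apply: runs_loop_free => //=.
rewrite m_i m_j m_b (inp a) // /greedy_step -subn_gt0 lt0n.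
case: eqP => [_|/eqP ji] /=; first by split.
case: eqP => [_|_] /=; first by split.
(* The two stores hit different cells, so the second does not read what the first wrote. *)
have ne_ij : (i == j) = false by apply/negP => /eqP eq_ij; rewrite eq_ij subnn in ji.
set m2 := update _ 9 _ _.
have tE : cap - (cap - (N - l1 i - (N - l1 i - (N - l1 j)))) =
    minn cap (minn (N - l1 i) (N - l1 j)) by rewrite !minn_subn.
have m2E b k : m2 b k =
    if b == 8 then if k == 5 then minn cap (minn (N - l1 i) (N - l1 j)) else m1 8 k
    else if b == 9 then if (k == i) || (k == j) then l1 k + minn cap (minn (N - l1 i) (N - l1 j)) else l1 k
    else m1 b k.
  rewrite /m2 /update /= !(mN, mcap, m_i, m_j, ml) tE [j == i]eq_sym ne_ij.
  case: (eqVneq b 8) => [->|_] /=; first by case: (k == 5).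
  case: (eqVneq b 9) => [->|_] //=; rewrite ml.
  by case: (eqVneq k j) => [->|_]; [rewrite orbT | rewrite orbF; case: eqP => [->|]].
split; last by move=> c c3; rewrite m2E /=; case: eqP => [c5|] //; rewrite c5 in c3.
split=> [b k b8|||k]; rewrite m2E //=.
have -> : (b == 8) = false by lia.
have -> : (b == 9) = false by lia.
exact: inp.
Qed.

(** * Scanning for the leading nonzero digit *)

Definition lead (d : nat -> nat) (n : nat) : nat := find (fun k => d k != 0) (iota 0 n).

Lemma lead_le d n : lead d n <= n.
Proof. by rewrite -[X in _ <= X](size_iota 0 n) find_size. Qed.

Lemma before_lead d n k : k < lead d n -> d k = 0.
Proof.
move=> lt_k; have := before_find 0 lt_k; rewrite nth_iota ?add0n.
  by move/negbFE/eqP.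
by apply: leq_trans lt_k (lead_le d n).
Qed.

Lemma at_lead d n : lead d n < n -> d (lead d n) != 0.
Proof.
move=> lt_n; have := nth_find 0 (_ : has (fun k => d k != 0) (iota 0 n)).
rewrite -/(lead d n) nth_iota // add0n; apply.
by rewrite has_find size_iota.
Qed.

Lemma lead_eq d n k : k <= n -> (forall j, j < k -> d j = 0) ->
  (k < n -> d k != 0) -> lead d n = k.
Proof.
move=> le_k d0 dk; apply/eqP; rewrite eqn_leq; apply/andP; split; rewrite leqNgt.
  apply/negP => lt_k; have := leq_trans lt_k (lead_le d n).
  by move/dk; rewrite (before_lead lt_k).
apply/negP => lt_k; have := at_lead (leq_trans lt_k le_k).
by rewrite (d0 _ lt_k).
Qed.

(** The loop test is a conjunction in truncated arithmetic: the digit is 0 and the position is below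
    [n]. Each zero digit doubles the capacity; a scan that finds nothing, where [lead] is [n],
    clears the edge cap. *)
Definition scan_prog (a : nat) : program :=
  Seq (set_reg 6 (Const 0))
 (Seq (While (Sub (Sub (Const 1) (Get a (reg 6)))
                  (Sub (Const 1) (Sub order_expr (reg 6))))
        (Seq (set_reg 3 (Add (reg 3) (reg 3)))
             (set_reg 6 (Add (reg 6) (Const 1)))))
      (If (Sub order_expr (reg 6)) Skip (set_reg 4 (Const 0)))).

Lemma runs_scan a m0 N cap l m n :
  0 < a < 8 -> m0 1 0 = n -> state m0 N cap l m ->
  runs (scan_prog a) m (n * 30 + 40)
    (state m0 (N * 2 ^ lead (m0 a) n) (if lead (m0 a) n < n then cap else 0) l).
Proof.
move=> a8 def_n st.
pose inv k m' := [/\ k <= n, state m0 (N * 2 ^ k) cap l m', m' 8 6 = k &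
  forall j, j < k -> m0 a j = 0].
have low b : 0 < b < 8 -> (b == 8) = false by lia.
apply: (@runs_le (3 + ((n * (15 + 13).+1 + 14) + 15).+1).+1); first by lia.
apply: runs_seq; apply: runs_loop_free => //=.
apply: runs_seq; apply: (runs_while (t := 15) (inv := inv)).
- move=> k m1 [le_kn [inp mN mcap ml] m6 d0] /=.
  rewrite (inp a) // (inp 1) // def_n m6.
  case: eqP => [stop|go].
    have lead_k : lead (m0 a) n = k by apply: lead_eq => //; lia.
    apply: runs_loop_free => //=; rewrite (inp 1) // def_n m6 lead_k subn_eq0.
    case: leqP => [ge_n|lt_n] //=; split=> //.
    by move=> b j b8; rewrite /update (low b) //= inp.
  split; first by lia.
  apply: runs_loop_free => //=; split; [lia| | |].
  + split=> //=; first by move=> b j b8; rewrite /update !(low b) //= inp.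
    by rewrite /update /= mN expnS; lia.
  + by rewrite /update /= m6 addn1.
  by move=> j; rewrite ltnS leq_eqVlt => /orP[/eqP ->|/d0 //]; lia.
split=> //; rewrite expn0 muln1; case: st => inp mN mcap ml; split=> //.
by move=> b k b8; rewrite /update (low b) //= inp.
Qed.

(** * The set-up phase and the two programs *)

Definition set_up : program :=
  Seq (set_reg 3 (Const 32)) (Seq (set_reg 4 (Const 1))
 (Seq (scan_prog 3) (Seq (scan_prog 4) (Seq (scan_prog 4) (greedy_prog 2))))).

(* The leading digit position [i] of [p] satisfies [2^-i <= p < 2^(1-i)], and
   likewise for [min eps 1]. If one of them is too small to be located among [n]
   digits, the capacity exceeds [n] and the edge cap is
   0, so that no vertex is saturated and every edge is queried. *)
Definition capacity (dp deps : nat -> nat) (n : nat) : nat :=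
  32 * 2 ^ lead dp n * 2 ^ lead deps n * 2 ^ lead deps n.

Definition edge_cap (dp deps : nat -> nat) (n : nat) : nat :=
  (lead dp n < n) && (lead deps n < n).

(** Both programs start with this phase, the second one recomputing the loads. Scanning [eps] twice
    squares its contribution to the capacity. *)
Lemma runs_set_up m0 n dp deps :
  m0 1 0 = n -> m0 3 =1 dp -> m0 4 =1 deps -> (forall k, m0 9 k = 0) ->
  runs set_up m0 (n * (n * 113 + 31) + n * 90 + 200)
    (state m0 (capacity dp deps n) (edge_cap dp deps n)
       (greedy (m0 2) (edge_cap dp deps n) (capacity dp deps n) n (fun=> 0))).
Proof.
move=> def_n def_p def_eps l0.
have lead_p : lead (m0 3) n = lead dp n.
  by apply: eq_find => k; rewrite def_p.
have lead_eps : lead (m0 4) n = lead deps n.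
  by apply: eq_find => k; rewrite def_eps.
apply: (@runs_le (3 + (3 + ((n * 30 + 40) + ((n * 30 + 40) + ((n * 30 + 40) +
  (n * (n * 113 + 31) + 14)).+1).+1).+1).+1).+1); first by lia.
apply: runs_seq; apply: runs_loop_free => //=.
apply: runs_seq; apply: runs_loop_free => //=.
have st0 : state m0 32 1 (fun=> 0) (update (update m0 8 3 32) 8 4 1).
  split=> //= b k b8; rewrite /update.
  by have -> : (b == 8) = false by lia.
apply: runs_seq; apply: (runs_post (runs_scan (a := 3) isT def_n st0)) => m1 st1.
apply: runs_seq; apply: (runs_post (runs_scan (a := 4) isT def_n st1)) => m2 st2.
apply: runs_seq; apply: (runs_post (runs_scan (a := 4) isT def_n st2)) => m3 st3.
have := runs_greedy (a := 2) isT def_n st3; rewrite lead_p lead_eps -/(capacity dp deps n).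
have -> : (if lead deps n < n then if lead deps n < n then if lead dp n < n then 1 else 0 else 0 else 0) =
  edge_cap dp deps n by rewrite /edge_cap; case: ltnP => _; case: ltnP.
exact.
Qed.

(** An adjacency entry is at most 1 and each full endpoint subtracts 1, so the stored value
    indicates an edge with two unsaturated ends. *)
Definition query_prog : program :=
  Seq set_up (for_pairs (Put 0 (Add (reg 2) (reg 1))
    (Sub (Sub (pair_cell 2) (Sub (Const 1) (slack (reg 0))))
         (Sub (Const 1) (slack (reg 1)))))).

Lemma runs_query m0 n dp deps (N := capacity dp deps n)
    (l := greedy (m0 2) (edge_cap dp deps n) N n (fun=> 0)) :
  m0 1 0 = n -> m0 3 =1 dp -> m0 4 =1 deps -> (forall k, m0 9 k = 0) ->
  runs query_prog m0 (1000 * (n + 1) ^ 2)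
    (fun m => forall i j, i < n -> j < n ->
       m 0 (i * n + j) = m0 2 (i * n + j) - (1 - (N - l i)) - (1 - (N - l j))).
Proof.
move=> def_n def_p def_eps l0.
apply: (@runs_le ((n * (n * 113 + 31) + n * 90 + 200) +
  (n * (n * (50 + 13) + 31) + 14)).+1); first by lia.
apply: runs_seq.
apply: (runs_post (runs_set_up def_n def_p def_eps l0)) => m1 st1.
pose inv i j m' := state m0 N (edge_cap dp deps n) l m' /\
  forall i' j', j' < n -> i' * n + j' < i * n + j ->
    m' 0 (i' * n + j') = m0 2 (i' * n + j') - (1 - (N - l i')) - (1 - (N - l j')).
apply: (runs_for_pairs (inv := inv)) => //.
- by move=> i j c x m2 c3 [st2 out2]; split=> //; apply: state_counter.
- by move=> i j m2 [[inp _ _ _] _]; rewrite inp.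
- by move=> i m2 lt_in [st2 out2]; split=> // i' j' lt_j lt_cell; apply: out2 => //; lia.
- move=> i j m2 lt_in lt_jn [[inp mN mcap ml] out2] m_i m_j m_b.
  apply: runs_loop_free => //=; split=> //; split.
    split=> //= a k a8; rewrite /update.
    by rewrite (_ : (a == 0) = false) /= ?(inp a) //; lia.
  move=> i' j' lt_j'; rewrite addnS ltnS leq_eqVlt /update /=.
  rewrite !(m_i, m_j, m_b, mN, ml) inp //.
  case: eqP => /= [eq_cell _|_ lt_cell]; last exact: out2.
  have n_gt0 : 0 < n by lia.
  have eq_i : i' = i.
    have := congr1 (divn^~ n) eq_cell.
    by rewrite /= !divnMDl // !divn_small // !addn0.
  by move: eq_cell; rewrite eq_i => /addnI ->.
- move=> m2 [_ out2] i j lt_in lt_jn; apply: out2 => //.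
  by rewrite addn0; apply: leq_trans (_ : i.+1 * n <= _); [lia | rewrite leq_mul2r lt_in orbT].
Qed.

(** Array 6 holds the realized queried edges. The edge cap is raised to [N], so that only vertex
    capacities limit the second pass. *)
Definition cover_prog : program :=
  Seq set_up (Seq (set_reg 4 (reg 3)) (Seq (greedy_prog 6)
    (for_loop 0 (Put 0 (reg 0) (Sub (Const 1) (slack (reg 0))))))).

Lemma runs_cover m0 n dp deps (N := capacity dp deps n)
    (l := greedy (m0 2) (edge_cap dp deps n) N n (fun=> 0))
    (l' := greedy (m0 6) N N n l) :
  m0 1 0 = n -> m0 3 =1 dp -> m0 4 =1 deps -> (forall k, m0 9 k = 0) ->
  runs cover_prog m0 (1000 * (n + 1) ^ 2)
    (fun m => forall i, i < n -> m 0 i = 1 - (N - l' i)).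
Proof.
move=> def_n def_p def_eps l0.
apply: (@runs_le ((n * (n * 113 + 31) + n * 90 + 200) +
  (4 + ((n * (n * 113 + 31) + 14) + (n * (50 + 13) + 10)).+1).+1).+1); first by lia.
apply: runs_seq.
apply: (runs_post (runs_set_up def_n def_p def_eps l0)) => m1 [inp mN mcap ml].
apply: runs_seq; apply: runs_loop_free => //=.
have st2 : state m0 N N l (update m1 8 4 (m1 8 3)).
  split=> //= b k b8; rewrite /update.
  by rewrite (_ : (b == 8) = false) /= ?(inp b) //; lia.
apply: runs_seq.
apply: (runs_post (runs_greedy (a := 6) isT def_n st2)) => m3 st3.
pose inv i m' := state m0 N N l' m' /\
  forall i', i' < i -> m' 0 i' = 1 - (N - l' i').
apply: (runs_for (inv := inv)) => //.
- by move=> i x m4 [st4 out4]; split=> //; apply: state_counter.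
- by move=> i m4 [[inp4 _ _ _] _]; rewrite inp4.
- move=> i m4 lt_in [[inp4 mN4 mcap4 ml4] out4] m_i.
  apply: runs_loop_free => //=; split=> //; split.
    split=> //= a k a8; rewrite /update.
    by rewrite (_ : (a == 0) = false) /= ?(inp4 a) //; lia.
  move=> i'; rewrite ltnS leq_eqVlt /update /= !(m_i, mN4, ml4).
  by case: eqP => /= [->|_ lt_i] //; apply: out4.
by move=> m4 [_ out4].
Qed.

(** * The algorithm *)

Local Open Scope ring_scope.

(** If [2 ^+ k * x < 1], the next scaled value is below 2, so reduction modulo 2 loses nothing and a
    zero digit puts it below 1 again. *)
Lemma real_array_zeros (R : realType) (m n : nat) (x : R) (i := lead (real_array m x) n) :
  0 <= x -> (n <= m)%N -> forall k, (k < i)%N -> 2 ^+ k * x < 1.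
Proof.
move=> x0 nm; elim=> [|k IHk] k_lt; have := before_lead k_lt; rewrite /real_array /=.
  by move/truncn0Pn; rewrite -ltNge expr0 mul1r.
have -> : (k < m)%N by have := lead_le (real_array m x) n; rewrite -/i; lia.
have lt2 : 2 ^+ k.+1 * x < 2 by rewrite exprS -mulrA -[ltRHS]mulr1 ltr_pM2l // IHk // ltnW.
have y0 : 0 <= 2 ^+ k.+1 * x by rewrite mulr_ge0 ?exprn_ge0.
have : (Num.truncn (2 ^+ k.+1 * x) < 2)%N by rewrite truncn_lt_nat.
move=> t2 even_t; have /truncn0Pn : Num.truncn (2 ^+ k.+1 * x) = 0%N by lia.
by rewrite -ltNge.
Qed.

(** Position 0 does not bound [x] from above, hence the minimum with 1. At position [k.+1], the zero
    in cell [k] gives [2 ^+ k * x < 1]. *)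
Lemma lead_real_le (R : realType) (m n : nat) (x : R) :
  0 <= x -> (n <= m)%N -> 2 ^+ lead (real_array m x) n * Num.min x 1 <= 2.
Proof.
move=> x0 nm; have := real_array_zeros x0 nm.
case: (lead _ _) => [_|k /(_ k (ltnSn k)) /ltW le1].
  rewrite expr0 mul1r; apply: le_trans (_ : 1 <= 2); last by rewrite ler1n.
  by rewrite ge_min lexx orbT.
rewrite exprS -mulrA -[leRHS]mulr1 ler_pM2l // (le_trans _ le1) //.
by rewrite ler_wpM2l ?exprn_ge0 // ge_min lexx.
Qed.

Lemma lead_real_ge (R : realType) (m n : nat) (x : R) (i := lead (real_array m x) n) :
  (i < n)%N -> (n <= m)%N -> 1 <= 2 ^+ i * x.
Proof.
move=> i_lt nm; have := at_lead i_lt; rewrite -/i /real_array.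
case: (i =P 0%N) => [->|_]; first by rewrite expr0 mul1r -truncn_gt0 lt0n.
have -> : (i <= m)%N by apply: leq_trans (ltnW i_lt) nm.
rewrite -truncn_gt0 lt0n; apply: contra_neq => ->; exact: mod0n.
Qed.

(** * Correctness of the query set and of the cover *)

Section Algorithm.
Variables (n : nat) (E : {set {set 'I_n}}) (dp deps : nat -> nat).
Hypothesis graphE : is_graph E.

Let N := capacity dp deps n.
Let cap := edge_cap dp deps n.

Definition fixed_load : nat -> nat := greedy (edges_array E) cap N n (fun=> 0%N).

Definition queried : {set {set 'I_n}} :=
  [set e in E | [forall v in e, fixed_load v < N]]%N.

Definition final_load (A : {set {set 'I_n}}) : nat -> nat :=
  greedy (edges_array A) N N n fixed_load.

Definition computed_cover (A : {set {set 'I_n}}) : {set 'I_n} :=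
  [set v : 'I_n | N <= final_load A v]%N.

Lemma queried_sub : queried \subset E.
Proof. by apply/subsetP => e; rewrite inE => /andP[]. Qed.

Lemma capacity_gt0 : (0 < N)%N.
Proof. by rewrite /N /capacity !muln_gt0 !expn_gt0. Qed.

(** A queried edge has no saturated endpoint, so maximality fills it to the cap. *)
Lemma fixed_loadP : exists y : {set 'I_n} -> nat,
  [/\ forall e, (y e <= cap)%N,
      forall v : 'I_n, fixed_load v = (\sum_(e in E | v \in e) y e)%N,
      forall v : 'I_n, (fixed_load v <= N)%N &
      forall e, e \in queried -> y e = cap].
Proof.
have [y [_ y_cap ly l_le sat]] :=
  greedyP cap graphE (subxx E) (l0 := fun=> 0%N) (fun=> leq0n N).
exists y; split=> // e; rewrite inE => /andP[eE /'forall_implyP unsat].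
case: (sat e eE) => // -[v ve lv]; have := unsat v ve.
by rewrite /fixed_load lv ltnn.
Qed.

Lemma card_edge e : e \in E -> #|e| = 2%N.
Proof. by move=> eE; apply/eqP; move/'forall_implyP: graphE; apply. Qed.

Lemma final_loadP (A : {set {set 'I_n}}) : A \subset queried ->
  exists z : {set 'I_n} -> nat,
  [/\ forall e, e \notin A -> z e = 0%N,
      forall v : 'I_n, final_load A v = (fixed_load v + \sum_(e in E | v \in e) z e)%N,
      forall v : 'I_n, (final_load A v <= N)%N &
      forall e, e \in A -> exists2 v, v \in e & v \in computed_cover A].
Proof.
move=> AQ; have AE := subset_trans AQ queried_sub.
have [_ [_ _ l_le _]] := fixed_loadP.
have [z [zA z_cap lz lf_le sat]] := greedyP N graphE AE l_le.
exists z; split=> // e eA; have eE := subsetP AE _ eA.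
case: (sat e eA) => [ze|[v ve lv]]; last first.
  by exists v; rewrite // inE /final_load lv.
(* An edge that carries [N] saturates any of its endpoints by itself. *)
have /card_gt0P[v ve] : (0 < #|e|)%N by rewrite card_edge.
exists v; rewrite // inE /final_load lz (bigD1 e) ?eE ?ve //= ze; lia.
Qed.

(** An edge outside [queried] has an endpoint saturated before the queries, which stays so; a
    queried one is covered by maximality of the second load. *)
Lemma cover_computed (H : {set {set 'I_n}}) :
  H \subset E -> vertex_cover H (computed_cover (H :&: queried)).
Proof.
move=> HE; have [z [_ lz _ sat]] := final_loadP (subsetIr H queried).
apply/vertex_coverP => e eH; have eE := subsetP HE _ eH.
case: (boolP (e \in queried)) => [eQ|]; first by apply: sat; rewrite inE eH.
rewrite inE eE /= => /'forall_implyP unsat.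
have /existsP[v /andP[ve lv]] : [exists v, (v \in e) && (N <= fixed_load v)%N].
  rewrite -[X in is_true X]negbK negb_exists; apply/negP => /forallP none.
  apply: unsat => v ve; rewrite ltnNge; have := none v; by rewrite ve.
by exists v; rewrite // inE lz; apply: leq_trans lv (leq_addr _ _).
Qed.

(** With cap 1 each queried edge puts one unit on its endpoints, whose loads are at most [N]. With
    cap 0 some leading position is [n], and the degree is at most [n <= 2 ^ n <= N]. *)
Lemma queried_degree : (max_degree queried <= N)%N.
Proof.
have [y [y_cap ly l_le yQ]] := fixed_loadP.
apply/bigmax_leqP => v _; rewrite /degree.
have [cap1|cap0] : cap = 1%N \/ cap = 0%N by rewrite /cap /edge_cap; case: (_ && _); [left|right].
  apply: leq_trans (l_le v); rewrite ly -sum1_card.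
  rewrite [leqRHS](bigID (fun e => e \in queried)) /=; apply: leq_trans (leq_addr _ _).
  rewrite leq_eqVlt; apply/orP; left; apply/eqP; apply: eq_big => [e|e].
    rewrite !inE; by case: (e \in E); case: (v \in e) => //=; rewrite ?andbT ?andbF.
  by rewrite !inE => /andP[/andP[eE eN] _]; rewrite yQ ?cap1 // inE eE.
have card_n : (#|[set e in queried | v \in e]| <= n)%N.
  have := leq_imset_card (fun u => [set v; u]) [set: 'I_n]; rewrite cardsT card_ord.
  apply: leq_trans; apply: subset_leq_card.
  apply/subsetP => e; rewrite inE => /andP[/(subsetP queried_sub) eE ve].
  have /eqP/cards2P[a [b [_ def_e]]] := card_edge eE.
  move: ve; rewrite def_e !inE => /orP[] /eqP ->; first exact: imset_f.
  by rewrite setUC; apply: imset_f.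
apply: leq_trans card_n _.
have lt_n : (n <= 2 ^ n)%N by apply: ltnW; apply: ltn_expl.
have pos a : (0 < 2 ^ a)%N by rewrite expn_gt0.
have mono a : (n <= a)%N -> (n <= 2 ^ a)%N.
  by move=> na; apply: leq_trans lt_n _; rewrite leq_exp2l.
rewrite /N /capacity; move: cap0; rewrite /cap /edge_cap.
case: ltnP => [_|/mono np]; last first.
  by move: (pos (lead deps n)) => ? _; rewrite -mulnA -[leqLHS]muln1 leq_mul ?muln_gt0 ?pos //; lia.
case: ltnP => [_|/mono ne] // _.
by rewrite -[leqLHS]mul1n leq_mul // !muln_gt0 !pos.
Qed.

Lemma queried_cell (i j : 'I_n) :
  (edges_array E (i * n + j) - (1 - (N - fixed_load i)) - (1 - (N - fixed_load j)) != 0)%N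
    = ([set i; j] \in queried).
Proof.
rewrite edges_arrayE inE; case: ([set i; j] \in E) => //=.
apply/idP/'forall_implyP => [cell v|unsat].
  by rewrite !inE => /orP[] /eqP ->; lia.
have := unsat i (set21 _ _); have := unsat j (set22 _ _); lia.
Qed.

Lemma expect_computed_cover (R : realType) (p delta : R) :
  0 < p <= 1 -> 0 < delta <= 1 ->
  (cap = 1%N -> 1 <= 2 * delta ^+ 2 * N%:R * p) ->
  (1 - delta) * expect_graph p E (fun H => #|computed_cover (H :&: queried)|%:R) <=
  2 * (1 + delta) * expect_graph p E (fun H => (nu H)%:R).
Proof.
move=> p01 delta01 thin; have [y [y_cap ly l_le _]] := fixed_loadP.
have [z z_spec] := fin_all_exists (fun H : {set {set 'I_n}} =>
  final_loadP (subsetIr H queried)).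
have load_eq (H : {set {set 'I_n}}) v :
    (\sum_(e in E | v \in e) (y e + z H e) = final_load (H :&: queried) v)%N.
  by case: (z_spec H) => _ -> _ _; rewrite big_split /= ly.
have cap_le1 : (cap <= 1)%N by rewrite /cap /edge_cap leq_b1.
apply: (@expect_tight_set _ _ _ _ _ N _ _ _ _ y _ _ z) => //.
- exact: capacity_gt0.
- by move=> e; apply: leq_trans (y_cap e) cap_le1.
- have [cap1|cap0] : cap = 1%N \/ cap = 0%N by lia.
    by right; apply: thin.
  by left; rewrite big1 // => e _; have := y_cap e; lia.
- by move=> H e eH; case: (z_spec H) => -> //; rewrite inE negb_and eH.
- by move=> H v _; rewrite load_eq; case: (z_spec H).
- move=> H v _; rewrite inE load_eq => ge_N; apply/eqP; rewrite eqn_leq ge_N andbT.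
  by case: (z_spec H).
Qed.

End Algorithm.

Theorem theorem6p3 (R : realType) :
  exists (K : R) (algQ algC : program) (T : {poly nat}),
    0 < K /\
    forall (eps p : R), 0 < eps -> 0 < p <= 1 ->
    forall (n : nat) (E : {set {set 'I_n}}), is_graph E ->
    exists (Q : {set {set 'I_n}})
           (C : {set {set 'I_n}} -> (T.[n]).-tuple bool -> {set 'I_n}),
      [/\ Q \subset E,
          (max_degree Q)%:R <= K / (Num.min eps 1 ^+ 3 * p),
          prob p E (fun H s => vertex_cover H (C (H :&: Q) s)) = 1,
          expect p E (fun H s => #|C (H :&: Q) s|%:R)
            <= (2 + eps) * expect_graph p E (fun H => (nu H)%:R)
        & computes_within algQ (instance T.[n] eps p E) T.[n]
            (fun m => outputs_edges m Q) /\
          forall (A : {set {set 'I_n}}) (s : (T.[n]).-tuple bool),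
            A \subset Q ->
            computes_within algC
              (instance T.[n] eps p E ++
                [:: edges_array Q; edges_array A; bits_array s])
              T.[n] (fun m => outputs_vertices m (C A s))].
Proof.
(* This bounds both running times; it is also the number of digits supplied, which exceeds the [n]
   positions scanned. *)
pose T : {poly nat} := 1000%N%:P * ('X + 1) ^+ 2.
have TE n : T.[n] = (1000 * (n + 1) ^ 2)%N.
  by rewrite /T !hornerE.
(* With [a] and [b] the powers of 2 found for [p] and [eps], the product [N * eps1 ^+ 3 * p] is
   [32 * (a * p) * (b * eps1) ^+ 2 * eps1], at most [32 * 2 * 4 * 1 = 256]. *)
exists 256, query_prog, cover_prog, T; split=> // eps p eps0 p01 n E graphE.
case/andP: (p01) => p0 p1; set m := T.[n].
have nm : (n <= m)%N by rewrite /m TE; lia.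
pose dp := real_array m p; pose deps := real_array m eps.
pose N := capacity dp deps n.
pose Q := queried E dp deps; pose C A := computed_cover E dp deps A.
set eps1 := Num.min eps 1.
have eps1_gt0 : 0 < eps1 by rewrite lt_min eps0 ltr01.
have eps1_le1 : eps1 <= 1 by rewrite ge_min lexx orbT.
have eps1_le : eps1 <= eps by rewrite ge_min lexx.
have NE : N%:R = 32 * (2 ^+ lead dp n * (2 ^+ lead deps n) ^+ 2) :> R.
  by rewrite /N /capacity !natrM !natrX expr2 !mulrA.
exists Q, (fun A _ => C A); split.
- exact: queried_sub.
- apply: le_trans (_ : N%:R <= _); first by rewrite ler_nat; apply: queried_degree.
  rewrite ler_pdivlMr ?mulr_gt0 ?exprn_gt0 // NE.
  have p_le2 : 2 ^+ lead dp n * p <= 2.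
    by have := lead_real_le (ltW p0) nm; rewrite min_l.
  have eps_le2 : 2 ^+ lead deps n * eps1 <= 2 := lead_real_le (ltW eps0) nm.
  set a := 2 ^+ lead dp n in p_le2 *; set b := 2 ^+ lead deps n in eps_le2 *.
  have -> : 32 * (a * b ^+ 2) * (eps1 ^+ 3 * p) = 32 * ((a * p) * (b * eps1) ^+ 2 * eps1) by ring.
  have ap0 : 0 <= a * p by rewrite mulr_ge0 ?exprn_ge0 // ltW.
  have be0 : 0 <= b * eps1 by rewrite mulr_ge0 ?exprn_ge0 // ltW.
  have : (b * eps1) ^+ 2 <= 4 by rewrite (_ : 4 = 2 ^+ 2) ?ler_pXn2r ?nnegrE //; ring.
  move: (sqr_ge0 (b * eps1)); move: ((b * eps1) ^+ 2) => u u0 u4.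
  have : a * p * u <= 2 * 4 by apply: ler_pM.
  have : 0 <= a * p * u by rewrite mulr_ge0.
  move: (a * p * u) => w w0 w8; nra.
- rewrite /prob /expect -[RHS](expect_graph_cst p E 1); apply: eq_expect_graph => H HE.
  by rewrite expect_bits_cst (cover_computed dp deps graphE HE).
(* This matches the factor 32 in the capacity: [2 * delta ^+ 2 * 32 = eps1 ^+ 2]. *)
- pose delta := eps1 / 8.
  rewrite (_ : expect _ _ _ = expect_graph p E (fun H => #|C (H :&: Q)|%:R)); last first.
    by apply: eq_expect_graph => H _; rewrite expect_bits_cst.
  have delta01 : 0 < delta <= 1 by rewrite /delta; apply/andP; split; lra.
  have := expect_computed_cover graphE p01 delta01 (dp := dp) (deps := deps).
  have nu0 : 0 <= expect_graph p E (fun H => (nu H)%:R).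
    by rewrite -[leLHS](expect_graph_cst p E 0); apply: le_expect_graph.
  rewrite -/C -/Q => bound; have {bound} : (1 - delta) * expect_graph p E (fun H => #|C (H :&: Q)|%:R) <=
      2 * (1 + delta) * expect_graph p E (fun H => (nu H)%:R).
    apply: bound; rewrite /edge_cap -/N NE.
    case: ltnP => // lt_p; case: ltnP => // lt_eps _.
    have p_ge1 : 1 <= 2 ^+ lead dp n * p := lead_real_ge lt_p nm.
    have eps_ge1 : 1 <= 2 ^+ lead deps n * eps1.
      rewrite /eps1; case: (leP eps 1) => _; first exact: lead_real_ge.
      by rewrite mulr1 exprn_ege1 // ler1n.
    set a := 2 ^+ lead dp n in p_ge1 *; set b := 2 ^+ lead deps n in eps_ge1 *.
    have -> : 2 * delta ^+ 2 * (32 * (a * b ^+ 2)) * p = (a * p) * (b * eps1) ^+ 2.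
      by rewrite /delta; field.
    by rewrite -[leLHS]mulr1 ler_pM // exprn_ege1.
  move: (expect_graph _ _ _) (expect_graph _ _ _) nu0 => x u u0 bound.
  apply: le_trans (_ : (2 + eps1) * u <= _); last by rewrite ler_wpM2r // lerD2l.
  have d1 : 0 < 1 - delta by rewrite /delta; lra.
  rewrite -(ler_pM2l d1); apply: le_trans bound _; rewrite mulrA ler_wpM2r //.
  (* As [eps1 = 8 * delta], the inequality [2 * (1 + delta) <= (1 - delta) * (2 + eps1)] amounts to
     [2 * delta <= 1]. *)
  by rewrite /delta; nra.
- split=> [|A s AQ].
    have := @runs_query (input_memory (instance m eps p E)) n dp deps.
    move=> /(_ erefl (fun=> erefl) (fun=> erefl) (fun=> erefl)).
    case=> t' [m' [ex le_t out]]; exists t', m'; rewrite -TE in le_t; split=> // i j.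
    by rewrite out // -queried_cell.
  have := @runs_cover (input_memory (instance m eps p E ++
    [:: edges_array Q; edges_array A; bits_array s])) n dp deps.
  move=> /(_ erefl (fun=> erefl) (fun=> erefl) (fun=> erefl)).
  case=> t' [m' [ex le_t out]]; exists t', m'; rewrite -TE in le_t; split=> // i.
  by rewrite out // subn_eq0 lt0n negbK subn_eq0 inE.
Qed.
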